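(* Let $\mathcal{D}_1,\dots,\mathcal{D}_n$ be probability distributions on $[0,1]$ having probability density functions bounded above by $q$, and let $0<\delta\le 1$. In time $\mathcal{O}(n^2\, q\,\log(q)\,\delta^{-1})$, the Equalizing Multipliers algorithm (described in the context), run with inputs $\delta$ and $q$ and an oracle for the resulting probabilities, computes a vector of multipliers $\vec\beta\in\mathbb{R}_{>0}^n$ such that, for all $i\in N=\{1,\dots,n\}$, $$\frac1n-\delta\le p_i(\vec\beta)\le \frac1n+\delta .$$
   Context: For $\vec\beta\in\mathbb{R}_{>0}^n$ and $i\in N$, the resulting probability of agent $i$ is $p_i(\vec\beta)=\mathbb{P}\left[\beta_i u_i=\max_{j\in N}\beta_j u_j\right]$, where $u_1,\dots,u_n$ are independent with $u_j\sim\mathcal{D}_j$. Running time is measured assuming that the algorithm has access to an oracle that computes the $p_i(\vec\beta)$ for a given $\vec\beta$ in constant time. For $\vec z\in\mathbb{Z}^n$ and $\epsilon>0$ write $(1+\epsilon)^{\vec z}=((1+\epsilon)^{z_1},\dots,(1+\epsilon)^{z_n})$, and for $S\subseteq N$ let $\mathbf{1}_S\in\{0,1\}^n$ be the indicator vector of $S$. Equalizing Multipliers algorithm: 1. Set $\epsilon\leftarrow\delta/(2q)$ and $\vec z\leftarrow\vec 0$. 2. While there exists $i\in N$ with $\left|p_i\big((1+\epsilon)^{\vec z}\big)-1/n\right|>\delta$: set $S\leftarrow\{i\in N : p_i\big((1+\epsilon)^{\vec z}\big)\le 1/n\}$ and then $\vec z\leftarrow\vec z+\mathbf{1}_S$.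 3. Return $(1+\epsilon)^{\vec z}$.
   Formalization: The running-time bound is stated for q ≥ q0, for every fixed q0 > 1, with a constant depending only on q0, since log(q) vanishes at q = 1 and the bound would then be 0; termination and correctness are stated for all q. *)

(* Defs.v *)
(* MathComp-Analysis, over an arbitrary realType. *)
From HB Require Import structures.
From mathcomp Require Import all_boot all_order all_algebra.
From mathcomp Require Import all_classical all_reals all_analysis.

Set Implicit Arguments.
Unset Strict Implicit.
Unset Printing Implicit Defensive.

Import Order.TTheory GRing.Theory Num.Theory.
Import numFieldNormedType.Exports.

Local Open Scope classical_set_scope.
Local Open Scope ring_scope.

Section Distributions.
Context {R : realType}.

Definition on_unit_interval (D : probability (measurableTypeR R) R) : Prop :=
  D `[0, 1]%classic = 1%E.

Definition has_density_le (D : probability (measurableTypeR R) R) (q : R) : Prop :=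
  exists f : R -> R,
    [/\ measurable_fun [set: R] f,
        forall x, 0 <= f x <= q &
        forall A : set R, measurable A ->
          D A = (\int[lebesgue_measure]_(x in A) (f x)%:E)%E].

Context {d : measure_display} {T : measurableType d} {P : probability T R}.
Context {n : nat}.

Definition has_distribution (X : {RV P >-> R})
    (D : probability (measurableTypeR R) R) : Prop :=
  forall A : set R, measurable A -> distribution P X A = D A.

Definition mutually_independent (u : 'I_n -> {RV P >-> R}) : Prop :=
  forall (S : {set 'I_n}) (A : 'I_n -> set R), (forall j, measurable (A j)) ->
    P [set w | forall j, j \in S -> A j (u j w)] =
    (\prod_(j in S) P (u j @^-1` A j))%E.

(* The index [i] belongs to the range of the maximum, so using the value at [i]
   as the starting value of the iterated [Num.max] does not change it. *)
Definition resulting_probability (u : 'I_n -> {RV P >-> R})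
    (beta : {ffun 'I_n -> R}) (i : 'I_n) : R :=
  fine (P [set w | beta i * u i w =
    \big[Num.max/beta i * u i w]_(j < n) (beta j * u j w)]).

End Distributions.

(* Time is counted in a unit-cost real RAM: a timed value is a result paired
   with the number of elementary operations (arithmetic operations, comparisons,
   array accesses, loop control, oracle queries) spent to obtain it. *)
Definition timed (A : Type) : Type := (A * nat)%type.

Definition ret A (a : A) : timed A := (a, 0%N).

Definition op A (a : A) : timed A := (a, 1%N).

Definition bind A B (m : timed A) (f : A -> timed B) : timed B :=
  ((f m.1).1, (m.2 + (f m.1).2)%N).

Notation "'let!' x := m 'in' f" := (bind m (fun x => f))
  (at level 200, x name, m at level 100, f at level 200,
   format "'[v' 'let!'  x  :=  m  'in' '/' f ']'").

Fixpoint for_each I S (s : seq I) (body : I -> S -> timed S) (x : S) : timed S :=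
  if s is i :: s' then
    let! _ := op tt in
    let! y := body i x in
    for_each s' body y
  else ret x.

(* [while_runs guard body x y t]: the loop started in [x] terminates in [y]
   after [t] elementary operations. *)
Inductive while_runs S (guard : S -> timed bool) (body : S -> timed S) :
    S -> S -> nat -> Prop :=
| While_stop x : (guard x).1 = false -> while_runs guard body x x (guard x).2
| While_iter x y t : (guard x).1 = true ->
    while_runs guard body (body x).1 y t ->
    while_runs guard body x y ((guard x).2 + (body x).2 + t)%N.

Lemma while_runs_det S (guard : S -> timed bool) (body : S -> timed S) x y1 t1 y2 t2 :
  while_runs guard body x y1 t1 -> while_runs guard body x y2 t2 ->
  y1 = y2 /\ t1 = t2.
Proof.
move=> H; elim: H y2 t2 => {x y1 t1} [x g0|x y t g1 _ IH] y2 t2 H2.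
  by case: H2 g0 => // x' y' t' ->.
case: H2 g1 IH => [x' -> //|x' y' t' _ H' _ IH].
by have [-> ->] := IH _ _ H'.
Qed.

Section Algorithm.
Context {R : realType} {n : nat}.

(* A query returns one coordinate of the vector of resulting probabilities. *)
Definition oracle_type : Type := {ffun 'I_n -> R} -> 'I_n -> R.

Definition new_array A (x : A) : timed {ffun 'I_n -> A} := ([ffun=> x], n).

Definition read A (a : {ffun 'I_n -> A}) (i : 'I_n) : timed A := op (a i).

Definition write A (a : {ffun 'I_n -> A}) (i : 'I_n) (x : A) :
    timed {ffun 'I_n -> A} :=
  op [ffun j => if j == i then x else a j].

Definition query (oracle : oracle_type) (b : {ffun 'I_n -> R}) (i : 'I_n) : timed R :=
  op (oracle b i).

(* The state consists of the exponents [z] and of the multipliers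
   [b = (1 + eps) ^ z].  Keeping [b] up to date costs one multiplication per
   increment of [z], so that no exponentiation has to be charged. *)
Definition state : Type := ({ffun 'I_n -> int} * {ffun 'I_n -> R})%type.

Definition em_guard (oracle : oracle_type) (delta : R) (s : state) : timed bool :=
  for_each (enum 'I_n) (fun i found =>
    let! p := query oracle s.2 i in
    let! m := op (n%:R^-1 : R) in
    let! e := op (p - m) in
    let! a := op `|e| in
    let! c := op (delta < a) in
    op (found || c)) false.

Definition em_small (oracle : oracle_type) (b : {ffun 'I_n -> R}) :
    timed {ffun 'I_n -> bool} :=
  let! S0 := new_array false in
  for_each (enum 'I_n) (fun i S =>
    let! p := query oracle b i in
    let! m := op (n%:R^-1 : R) in
    let! c := op (p <= m) in
    write S i c) S0.

Definition em_raise (eps : R) (i : 'I_n) (s : state) : timed state :=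
  let! zi := read s.1 i in
  let! zi' := op (zi + 1) in
  let! z' := write s.1 i zi' in
  let! bi := read s.2 i in
  let! r := op (1 + eps) in
  let! bi' := op (bi * r) in
  let! b' := write s.2 i bi' in
  ret (z', b').

Definition em_body (oracle : oracle_type) (eps : R) (s : state) : timed state :=
  let! S := em_small oracle s.2 in
  for_each (enum 'I_n) (fun i s' =>
    let! c := read S i in
    if c then em_raise eps i s' else ret s') s.

Definition em_eps (delta q : R) : timed R :=
  let! q2 := op (2 * q) in
  op (delta / q2).

Definition em_init : timed state :=
  let! z := new_array (0 : int) in
  let! b := new_array (1 : R) in
  ret (z, b).

(* The algorithm terminates after [t] elementary operations, with exponents [z]
   and output [b]; the last summand is the cost of writing the output. *)
Definition em_run (oracle : oracle_type) (delta q : R)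
    (z : {ffun 'I_n -> int}) (b : {ffun 'I_n -> R}) (t : nat) : Prop :=
  exists2 t' : nat,
    while_runs (em_guard oracle delta) (em_body oracle (em_eps delta q).1)
      em_init.1 (z, b) t' &
    t = ((em_eps delta q).2 + em_init.2 + t' + n)%N.

End Algorithm.

Arguments oracle_type R n : clear implicits.

(* Main.v *)
(** With [e = delta / (2 q)], multiplying a single multiplier by [1 + e] raises
    the corresponding probability by at most [2 q e = delta].  A round of the
    algorithm therefore moves every probability by at most [delta], towards
    [1/n], so that an agent outside the band [1/n +- delta] has been on the same
    side of it since the start: its exponent is [0] throughout if it is too
    high, and equals the number of rounds if it is too low.  On the other hand
    [2 q beta_j <= beta_i] forces [p_j <= p_i], so no exponent ever drifts away
    from the one of such an agent by more than [L ~ ln (2 q) / ln (1 + e)].  As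
    the probabilities add up to [1], every round raises at least one agent and,
    while some agent is too low, leaves out at least one; summing the distances
    to the extreme agent over all agents bounds the number of rounds by [n L]. *)
Require Import Defs.
From HB Require Import structures.
From mathcomp Require Import all_boot all_order all_algebra.
From mathcomp Require Import all_classical all_reals all_analysis.
From mathcomp Require Import measurable_realfun zify ring lra.

Set Implicit Arguments.
Unset Strict Implicit.
Unset Printing Implicit Defensive.

Import Order.TTheory GRing.Theory Num.Theory.
Import numFieldNormedType.Exports.

Local Open Scope classical_set_scope.
Local Open Scope ring_scope.

(** * Real-valued probabilities of events *)

Section Probability.
Context {R : realType} {d : measure_display} {T : measurableType d}.
Variable P : probability T R.

Definition pr (A : set T) : R := fine (P A).

Lemma prE A : measurable A -> P A = (pr A)%:E.
Proof. by move=> mA; rewrite /pr fineK// fin_num_measure. Qed.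

Lemma pr_ge0 A : 0 <= pr A.
Proof. exact: fine_ge0. Qed.

Lemma prT : pr setT = 1.
Proof. by rewrite /pr probability_setT. Qed.

Lemma le_pr A B : measurable A -> measurable B -> A `<=` B -> pr A <= pr B.
Proof. by move=> mA mB AB; rewrite -lee_fin -!prE// le_measure// inE. Qed.

Lemma pr_le1 A : measurable A -> pr A <= 1.
Proof. by move=> mA; rewrite -lee_fin -prE// probability_le1. Qed.

Lemma prD A B : measurable A -> measurable B -> A `<=` B ->
  pr (B `\` A) = pr B - pr A.
Proof.
move=> mA mB AB; apply: EFin_inj.
rewrite EFinB -!prE//; last exact: measurableD.
rewrite measureD//; last by rewrite ltey_eq fin_num_measure.
by rewrite (setIidr AB).
Qed.

Lemma prU_le A B : measurable A -> measurable B ->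
  pr (A `|` B) <= pr A + pr B.
Proof.
move=> mA mB; rewrite -lee_fin EFinD -!prE//; last exact: measurableU.
exact: measureU2.
Qed.

Lemma measurable_RV_le (X Y : {RV P >-> R}) (a b : R) :
  measurable [set w | a * X w <= b * Y w].
Proof.
rewrite -[X in measurable X]setTI; apply: measurable_fun_le => //;
  exact: measurable_funM.
Qed.

End Probability.
Arguments pr {R d T} P A.
Arguments pr_ge0 {R d T} P A.

Lemma measurable_forall d (T : measurableType d) (I : finType) (p : pred I)
    (A : I -> set T) : (forall i, p i -> measurable (A i)) ->
  measurable [set w | forall i, p i -> A i w].
Proof.
move=> mA; rewrite [X in measurable X](_ : _ = \bigcap_(i in [set i | p i]) A i).
  by apply: fin_bigcap_measurable => //; exact: finite_finset.
by apply/seteqP; split=> w /= h i; exact: h.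
Qed.

(** * Independent utilities with bounded densities *)

Section IndependentUtilities.
Context {R : realType} {d : measure_display} {T : measurableType d}.
Context {P : probability T R} {n : nat}.
Variables (D : 'I_n -> probability (measurableTypeR R) R) (q : R).
Variable u : 'I_n -> {RV P >-> R}.
Hypothesis D01 : forall j, on_unit_interval (D j).
Hypothesis Dq : forall j, has_density_le (D j) q.
Hypothesis hu : mutually_independent u.
Hypothesis uD : forall j, has_distribution (u j) (D j).

Lemma measurable_preim (j : 'I_n) (A : set R) : measurable A ->
  measurable (u j @^-1` A).
Proof. by move=> mA; rewrite -[X in measurable X]setTI; apply: measurable_funP. Qed.

Lemma pr_preim (j : 'I_n) (A : set R) : measurable A ->
  (pr P (u j @^-1` A))%:E = D j A.
Proof. by move=> mA; rewrite -uD// prE//; exact: measurable_preim. Qed.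

(** The only form in which the density bound enters the argument; the case [a = b] makes points
    null. *)
Lemma pr_preim_itv (j : 'I_n) (a b : R) : a <= b ->
  pr P (u j @^-1` `[a, b]%classic) <= q * (b - a).
Proof.
move=> ab; rewrite -lee_fin pr_preim//; have [f [mf f0q ->]] := Dq j => //.
apply: (@le_trans _ _ (\int[lebesgue_measure]_(x in `[a, b]%classic) (cst q%:E x)))%E.
  apply: ge0_le_integral => //.
  - by move=> x _; rewrite lee_fin; case/andP: (f0q x).
  - by apply/measurable_EFinP; apply: measurable_funTS.
  - by move=> x _; rewrite lee_fin; case/andP: (f0q x).
rewrite integral_cst//= lebesgue_measure_itv/= lte_fin EFinM.
move: ab; rewrite le_eqVlt => /predU1P[->|->]; last by rewrite EFinB.
by rewrite ltxx subrr.
Qed.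

(** The whole mass [1] sits on an interval of length [1]. *)
Lemma density_bound_ge1 (j : 'I_n) : 1 <= q.
Proof.
have := @pr_preim_itv j 0 1 ler01; rewrite subr0 mulr1; apply: le_trans.
by rewrite -lee_fin pr_preim// D01.
Qed.

(** The value [0] is excluded, at the price of a null event, so that a strictly larger multiplier
    gives a strictly larger product; this is what breaks ties in [pr_wins_sum]. *)
Definition unit_utilities : set T := [set w | forall j, 0 < u j w <= 1].

Lemma measurable_unit_utilities : measurable unit_utilities.
Proof.
rewrite [X in measurable X](_ : _ =
  [set w | forall j, true -> (u j @^-1` `]0, 1]%classic) w]).
  by apply: measurable_forall => j _; exact: measurable_preim.
by apply/seteqP; split=> w /= h j; have := h j; rewrite in_itv//= => /(_ isT).
Qed.

Lemma pr_rectangle (A : 'I_n -> set R) : (forall j, measurable (A j)) ->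
  pr P [set w | forall j, A j (u j w)] = \prod_j pr P (u j @^-1` A j).
Proof.
move=> mA; apply: EFin_inj; rewrite -prE.
  have := hu [set: 'I_n]%SET mA; rewrite (_ : [set w | _] = [set w | forall j, A j (u j w)]).
    move=> ->; rewrite -prodEFin; apply: eq_big => [j|j _]; first by rewrite inE.
    by rewrite prE//; exact: measurable_preim.
  by apply/seteqP; split=> w /= h j *; apply: h; rewrite ?inE.
rewrite [X in measurable X](_ : _ =
  [set w | forall j, true -> (u j @^-1` A j) w]).
  by apply: measurable_forall => j _; exact: measurable_preim.
by apply/seteqP; split=> w /= h j *; exact: h.
Qed.

Lemma pr_unit_utilities : pr P unit_utilities = 1.
Proof.
rewrite (_ : unit_utilities = [set w | forall j, `]0, 1]%classic (u j w)]); last first.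
  by apply/seteqP; split=> w /= h j; have := h j; rewrite in_itv.
rewrite (@pr_rectangle (fun=> `]0, 1]%classic))// big1// => j _; apply/eqP; rewrite eq_le pr_le1 /=; last first.
  exact: measurable_preim.
have h0 : pr P (u j @^-1` `[0, 0]%classic) <= 0.
  by rewrite (le_trans (pr_preim_itv _ _))// subrr mulr0.
have h1 : pr P (u j @^-1` `[0, 1]%classic) = 1.
  by apply: EFin_inj; rewrite pr_preim// D01.
rewrite -{1}h1 -[leRHS]add0r; apply: le_trans (lerD h0 (lexx _)).
apply: le_trans (prU_le _ _ _); try exact: measurable_preim.
apply: le_pr; try exact: measurable_preim.
  by apply: measurableU; exact: measurable_preim.
move=> w /=; rewrite !in_itv/= => /andP[w0 w1].
by case: (ltrP 0 (u j w)) => w0'; [right|left]; apply/andP.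
Qed.

(** Lets inclusions of events be checked only where all utilities lie in []0, 1]]. *)
Lemma le_pr_as (A B : set T) : measurable A -> measurable B ->
  A `&` unit_utilities `<=` B -> pr P A <= pr P B.
Proof.
move=> mA mB AB; have mU := measurable_unit_utilities.
have h0 : pr P (setT `\` unit_utilities) = 0.
  by rewrite prD// prT pr_unit_utilities subrr.
rewrite -[leRHS]addr0 -h0; apply: le_trans (prU_le _ mB _); last exact: measurableD.
apply: le_pr => //; first by apply: measurableU => //; exact: measurableD.
move=> w Aw; have [Uw|Uw] := pselect (unit_utilities w); last by right.
by left; exact: AB.
Qed.

Definition others_in (i : 'I_n) (A : 'I_n -> set R) : set T :=
  [set w | forall j, j != i -> A j (u j w)].

Lemma measurable_others_in i A : (forall j, measurable (A j)) ->
  measurable (others_in i A).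
Proof.
by move=> mA; apply: measurable_forall => j _; exact: measurable_preim.
Qed.

Lemma pr_others_in i (A : 'I_n -> set R) (B : set R) :
  (forall j, measurable (A j)) -> measurable B ->
  pr P (others_in i A `&` u i @^-1` B) =
  pr P (others_in i A) * pr P (u i @^-1` B).
Proof.
move=> mA mB.
have rect C : measurable C -> pr P (others_in i A `&` u i @^-1` C) =
    pr P (u i @^-1` C) * \prod_(j | j != i) pr P (u j @^-1` A j).
  move=> mC; rewrite (_ : _ `&` _ =
      [set w | forall j, (if j == i then C else A j) (u j w)]).
    rewrite (@pr_rectangle (fun j => if j == i then C else A j)); last by move=> j; case: ifP.
    rewrite (bigD1 i)//= eqxx; congr (_ * _).
    by apply: eq_bigr => j /negbTE ->.
  apply/seteqP; split=> w /=.
    by move=> [h Cw] j; case: ifPn => [/eqP ->//|]; exact: h.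
  move=> h; split; last by have := h i; rewrite eqxx.
  by move=> j /negbTE ji; have := h j; rewrite ji.
(* With the whole line as the constraint on [u i], [rect] identifies the product over the other
   agents as the probability of [others_in i A]. *)
have := rect setT measurableT.
rewrite preimage_setT setIT prT mul1r => ->.
by rewrite rect// mulrC.
Qed.

End IndependentUtilities.

(** * Effect of a small increase of one multiplier *)

Section Strip.
Context {R : realType} {d : measure_display} {T : measurableType d}.
Context {P : probability T R} {n : nat}.
Variables (D : 'I_n -> probability (measurableTypeR R) R) (q : R).
Variable u : 'I_n -> {RV P >-> R}.
Hypothesis D01 : forall j, on_unit_interval (D j).
Hypothesis Dq : forall j, has_density_le (D j) q.
Hypothesis hu : mutually_independent u.
Hypothesis uD : forall j, has_distribution (u j) (D j).

Let as_le := le_pr_as D01 Dq hu uD.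

(** The multiplier [c] of agent [i] is kept apart from [b], so that it can vary while the competing
    terms stay fixed. Ties count as wins. *)
Definition wins (c : R) (b : 'I_n -> R) (i : 'I_n) : set T :=
  [set w | forall j, j != i -> b j * u j w <= c * u i w].

(** As [x] varies, its probability is the distribution function of the maximum of the competing
    terms, which is independent of [u i]. *)
Definition below (x : R) (b : 'I_n -> R) (i : 'I_n) : set T :=
  [set w | forall j, j != i -> b j * u j w <= x].

Lemma measurable_wins c b i : measurable (wins c b i).
Proof.
apply: (@measurable_forall _ T 'I_n (fun j => j != i)
  (fun j => [set w | b j * u j w <= c * u i w])).
by move=> j _; exact: measurable_RV_le.
Qed.

Lemma belowE x b i : (forall j, 0 < b j) ->
  below x b i = others_in u i (fun j => `]-oo, x / b j]%classic).
Proof.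
by move=> b0; apply/seteqP; split=> w /= h j ji; have := h j ji;
  rewrite /= in_itv/= ler_pdivlMr// mulrC.
Qed.

Lemma measurable_below x b i : (forall j, 0 < b j) -> measurable (below x b i).
Proof. by move=> b0; rewrite belowE//; exact: measurable_others_in. Qed.

Lemma pr_below x b i (B : set R) : (forall j, 0 < b j) -> measurable B ->
  pr P (below x b i `&` u i @^-1` B) =
  pr P (below x b i) * pr P (u i @^-1` B).
Proof. by move=> b0 mB; rewrite belowE// pr_others_in. Qed.

(* Conditionally on the maximum [M] of the other terms, the event confines
   [u i] to [[M / ((1 + e) c), M / c[], an interval of length at most [e] once
   cut at [1]; [M] is discretized on a grid of mesh at most [e], which costs the
   factor [2]. *)
Lemma pr_strip_le (c e : R) (b : 'I_n -> R) (i : 'I_n) :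
  0 < c -> 0 < e -> (forall j, 0 < b j) ->
  pr P (wins ((1 + e) * c) b i `\` wins c b i) <= 2 * q * e.
Proof.
move=> c0 e0 b0; have mU := measurable_unit_utilities u.
have q1 := density_bound_ge1 D01 Dq uD i.
set St := _ `\` _.
have mSt : measurable St by apply: measurableD; exact: measurable_wins.
(* [N] cells of mesh [h <= e] cover [[0, 1 + e]]. As utilities are at most [1], winning with
   multiplier [(1 + e) * c] keeps every competing term at most [c * (N * h)]. *)
set N := (Num.truncn ((1 + e) / e)).+1; pose h := (1 + e) / N%:R.
have N0 : 0 < N%:R :> R by rewrite ltr0n.
have h0 : 0 < h by rewrite divr_gt0//; lra.
have he : h <= e.
  rewrite ler_pdivrMr// mulrC -ler_pdivrMr//; apply: ltW.
  by rewrite /N Num.Theory.truncnS_gt.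
have mB x : measurable (below x b i) by exact: measurable_below.
have mSB x : measurable (St `&` unit_utilities u `&` below x b i).
  by apply: measurableI => //; exact: measurableI.
(* Each cell contributes at most [2 * q * e] times the increment of the probability of [below], so
   the sum over the grid telescopes. *)
have strip k : (k <= N)%N ->
    pr P (St `&` unit_utilities u `&` below (c * (k%:R * h)) b i) <=
    2 * q * e * pr P (below (c * (k%:R * h)) b i).
  elim: k => [|k IH] kN.
    rewrite mul0r mulr0 (_ : St `&` _ `&` _ = set0) ?/pr ?measure0.
      by rewrite mulr_ge0 ?fine_ge0// mulr_ge0; lra.
    rewrite -subset0 => w [[[_ nW] Uw] Ew]; apply: nW => j ji.
    by apply: le_trans (Ew j ji) _; rewrite mulr_ge0// ltW//; case/andP: (Uw i).
  set E0 := below (c * (k%:R * h)) b i; set E1 := below _ b i.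
  set x := k%:R * h; set y := k.+1%:R * h.
  have x0 : 0 <= x by rewrite mulr_ge0// ltW.
  have yE : y = x + h by rewrite /x /y -natr1 mulrDl mul1r.
  have ye : y <= 1 + e.
    rewrite -[leRHS](_ : N%:R * h = _); last by rewrite mulrC divfK ?gt_eqF.
    by rewrite ler_pM2r// ler_nat.
  (* On the current cell the strip forces [u i] into [[a, m]]; as [a <= 1], the length is at most
     [y - a = h + a * e <= 2 * e]. *)
  pose m := Num.min y 1; pose a := x / (1 + e).
  have aE : a * (1 + e) = x by rewrite divfK// gt_eqF//; lra.
  have a0 : 0 <= a by rewrite divr_ge0//; lra.
  have am : m - a <= 2 * e /\ a <= m.
    have a1 : a <= 1 by rewrite /a ler_pdivrMr; lra.
    have ae1 : a * e <= e by rewrite ler_piMl// ltW.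
    have ae0 : 0 <= a * e by rewrite mulr_ge0 // ltW.
    by rewrite /m; case: (lerP y 1) => y1; split; lra.
  pose I := u i @^-1` `[a, m]%classic.
  have mI : measurable I by exact: measurable_preim.
  have E01 : E0 `<=` E1.
    move=> w Ew j ji; apply: le_trans (Ew j ji) _.
    by rewrite ler_pM2l// -/x -/y yE lerDl ltW.
  have sub : St `&` unit_utilities u `&` E1 `<=`
      (St `&` unit_utilities u `&` E0) `|` ((E1 `&` I) `\` (E0 `&` I)).
    move=> w [[Sw Uw] E1w]; have [E0w|nE0w] := pselect (E0 w); first by left.
    right; split; last by case.
    split => //; rewrite /I/= in_itv/=; apply/andP; split.
      rewrite leNgt; apply/negP => ua; apply: nE0w => j ji.
      apply: le_trans (Sw.1 j ji) _.
      have : c * u i w * (1 + e) <= c * a * (1 + e).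
        by rewrite ler_pM2r; [rewrite ler_pM2l// ltW|lra].
      by rewrite -/x -aE => ?; lra.
    rewrite /m le_min; case/andP: (Uw i) => _ ->; rewrite andbT.
    rewrite leNgt; apply/negP => yu; apply: Sw.2 => j ji.
    by apply: le_trans (E1w j ji) _; rewrite ler_pM2l// ltW.
  apply: le_trans (le_pr P _ _ sub) _.
  - exact: mSB.
  - apply: measurableU; first exact: mSB.
    by apply: measurableD; apply: measurableI => //; exact: mB.
  apply: le_trans (prU_le P _ _) _.
  - exact: mSB.
  - by apply: measurableD; apply: measurableI => //; exact: mB.
  rewrite prD; first last.
  - exact: setSI.
  - by apply: measurableI => //; exact: mB.
  - by apply: measurableI => //; exact: mB.
  rewrite !pr_below// -mulrBl.
  have {}IH := IH (ltnW kN).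
  have D0 : 0 <= pr P E1 - pr P E0 by rewrite subr_ge0; apply: le_pr => //; exact: mB.
  have pI : pr P I <= 2 * q * e.
    apply: le_trans (pr_preim_itv Dq uD i am.2) _.
    by rewrite [2 * q]mulrC -mulrA ler_pM2l; [exact: am.1|lra].
  have := ler_wpM2l D0 pI; rewrite -/E0 in IH *; lra.
apply: le_trans (as_le (B := St `&` unit_utilities u `&` below (c * (N%:R * h)) b i)
  mSt _ _) _.
- exact: mSB.
- move=> w [Sw Uw]; split => //= j ji; apply: le_trans (Sw.1 j ji) _.
  have [_ u1] := andP (Uw i).
  rewrite [N%:R * h]mulrC divfK ?gt_eqF// mulrC [c * _]mulrC ler_piMl//.
  by rewrite mulr_ge0//; lra.
apply: le_trans (strip N (leqnn _)) _.
by rewrite ler_piMr ?pr_le1// mulr_ge0//; lra.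
Qed.

End Strip.

(** * Monotonicity, Lipschitz bound and normalization of the resulting probabilities *)

Section WinningProbability.
Context {R : realType} {d : measure_display} {T : measurableType d}.
Context {P : probability T R} {n : nat}.
Variables (D : 'I_n -> probability (measurableTypeR R) R) (q : R).
Variable u : 'I_n -> {RV P >-> R}.
Hypothesis D01 : forall j, on_unit_interval (D j).
Hypothesis Dq : forall j, has_density_le (D j) q.
Hypothesis hu : mutually_independent u.
Hypothesis uD : forall j, has_distribution (u j) (D j).

Let as_le := le_pr_as D01 Dq hu uD.

Lemma resulting_probabilityE (b : {ffun 'I_n -> R}) i :
  resulting_probability u b i = pr P (wins u (b i) b i).
Proof.
rewrite /resulting_probability /pr; congr (fine (P _)).
apply/seteqP; split=> w /= h.
  by move=> j ji; rewrite h; apply: (le_bigmax _ (fun k => b k * u k w)).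
apply/eqP; rewrite eq_le bigmax_ge_id /=; apply/bigmax_leP; split => // j _.
by have [->//|ji] := eqVneq j i; exact: h.
Qed.

(** Winning depends only on the ratios [b i / b j]; the hypothesis, with denominators cleared, says
    that they grow up to a factor [k]. It serves with [k = 1] and [k = 1 + e]. *)
Lemma le_pr_wins (k : R) (b b' : 'I_n -> R) i :
  0 < b i -> 0 <= k * b' i ->
  (forall j, j != i -> b i * b' j <= k * (b j * b' i)) ->
  pr P (wins u (b i) b i) <= pr P (wins u (k * b' i) b' i).
Proof.
move=> bi k0 kb; apply: as_le; try exact: measurable_wins.
move=> w [Ww Uw] j ji; rewrite -(ler_pM2l bi) !mulrA.
have [uj _] := andP (Uw j).
have := ler_wpM2r (ltW uj) (kb j ji); have := ler_wpM2l k0 (Ww j ji); lra.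
Qed.

Lemma pr_wins_mono (b b' : 'I_n -> R) i : 0 < b i -> 0 < b' i ->
  (forall j, j != i -> b i * b' j <= b j * b' i) ->
  pr P (wins u (b i) b i) <= pr P (wins u (b' i) b' i).
Proof.
move=> bi bi' bb; rewrite -[X in wins u X b']mul1r.
by apply: le_pr_wins; rewrite ?mul1r ?ltW// => j ji; rewrite mul1r bb.
Qed.

(** The loss of a factor [1 + e] in the ratios is made up by raising the multiplier of [i] alone,
    and [pr_strip_le] bounds what that gains. *)
Lemma pr_wins_lip (e : R) (b b' : 'I_n -> R) i : 0 < e -> 0 < b i ->
  (forall j, 0 < b' j) ->
  (forall j, j != i -> b i * b' j <= (1 + e) * (b j * b' i)) ->
  pr P (wins u (b i) b i) <= pr P (wins u (b' i) b' i) + 2 * q * e.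
Proof.
move=> e0 bi b0 bb.
apply: le_trans (le_pr_wins _ _ bb) _ => //; first by rewrite mulr_ge0 ?ltW ?addr_gt0.
have := pr_strip_le D01 Dq hu uD i (b0 i) e0 b0.
move=> S; rewrite -lerBlDl; apply: le_trans S; rewrite lerBlDr.
apply: le_trans (prU_le P _ _); [|apply: measurableD| ]; try exact: measurable_wins.
apply: le_pr; try (apply: measurableU; try apply: measurableD); try exact: measurable_wins.
by move=> w Ww; have [|] := pselect (wins u (b' i) b' i w); [right|left].
Qed.

(* Compare both with the event [V] that [u j <= 1] and that no third agent
   exceeds [b j]: if [j] wins then [V] holds and [u i <= b j / b i <= 1 / (2 q)],
   which has conditional probability at most 1/2, and otherwise [V] makes [i] win. *)
Lemma pr_wins_swap (b : 'I_n -> R) i j : (forall k, 0 < b k) ->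
  2 * q * b j <= b i ->
  pr P (wins u (b j) b j) <= pr P (wins u (b i) b i).
Proof.
move=> b0 bij; have q1 := density_bound_ge1 D01 Dq uD i.
have bji : b j < b i.
  have := b0 j; have : 0 <= (q - 1) * b j by rewrite mulr_ge0 ?subr_ge0// ltW.
  lra.
have ji : j != i by apply: contraTneq bji => ->; rewrite ltxx.
pose A k := if k == j then `]-oo, 1]%classic else `]-oo, b j / b k]%classic.
have mA k : measurable (A k) by rewrite /A; case: ifP.
pose I := u i @^-1` `[0, b j / b i]%classic.
have mI : measurable I by exact: measurable_preim.
have mV : measurable (others_in u i A) by exact: measurable_others_in.
have r0 : 0 <= b j / b i by rewrite divr_ge0// ltW.
have pI : pr P I <= 2^-1.
  apply: le_trans (pr_preim_itv Dq uD i r0) _.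
  by rewrite subr0 mulrA ler_pdivrMr//; lra.
have pj : pr P (wins u (b j) b j) <= pr P (others_in u i A) * 2^-1.
  apply: le_trans (ler_wpM2l (pr_ge0 P _) pI).
  rewrite -pr_others_in//; apply: as_le; first exact: measurable_wins.
    exact: measurableI.
  move=> w [Ww Uw]; have [u0 u1] := andP (Uw j).
  have Wk k : k != j -> u k w <= b j / b k.
    move=> kj; rewrite ler_pdivlMr// mulrC (le_trans (Ww k kj))//.
    by rewrite ler_piMr// ltW.
  split=> [k ki|]; last first.
    by rewrite /I/= in_itv/= Wk ?andbT 1?eq_sym//; case/andP: (Uw i) => /ltW.
  by rewrite /A; case: ifPn => kj /=; rewrite in_itv//= ?(eqP kj)// Wk.
have : pr P (others_in u i A) <= pr P (others_in u i A) * 2^-1 +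
    pr P (wins u (b i) b i).
  apply: le_trans (_ : _ <= pr P ((others_in u i A `&` I) `|` wins u (b i) b i)) _.
    apply: as_le => //.
      by apply: measurableU; [exact: measurableI|exact: measurable_wins].
    move=> w [Vw Uw]; have [ui|ui] := leP (u i w) (b j / b i); [left|right].
      split => //; rewrite /I/= in_itv/= ui andbT.
      by case/andP: (Uw i) => /ltW.
    move: ui; rewrite ltr_pdivrMr// mulrC => ui k ki.
    apply: le_trans (ltW ui); have := Vw k ki; rewrite /A.
    case: ifPn => [/eqP ->|kj] /=; rewrite in_itv/=.
      by move=> uj; rewrite ler_piMr// ltW.
    by rewrite ler_pdivlMr// mulrC.
  apply: le_trans (prU_le P _ _) _; [exact: measurableI|exact: measurable_wins|].
  by rewrite pr_others_in// lerD2r ler_wpM2l// pr_ge0.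
lra.
Qed.

(** Some agent always attains the maximum, so the sum is at least [1]. Strict wins are disjoint and
    ties lie in strips of arbitrarily small probability, so it is at most [1]. *)
Lemma pr_wins_sum (b : 'I_n -> R) : (0 < n)%N -> (forall k, 0 < b k) ->
  \sum_i pr P (wins u (b i) b i) = 1.
Proof.
move=> n0 b0; have q1 := density_bound_ge1 D01 Dq uD (Ordinal n0).
have mW c i := measurable_wins u c b i.
apply/eqP; rewrite eq_le; apply/andP; split; last first.
  have [mU] : measurable (\big[setU/set0]_i wins u (b i) b i) /\
      pr P (\big[setU/set0]_i wins u (b i) b i) <= \sum_i pr P (wins u (b i) b i).
    elim/big_ind2: _ => [|A x B y [mA Ax] [mB By]|i _]; last by split.
      by rewrite /pr measure0.
    split; first exact: measurableU.
    by apply: le_trans (prU_le P mA mB) _; exact: lerD.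
  apply: le_trans; rewrite -[leLHS](prT P).
  apply: le_pr => // w _; rewrite -bigcup_seq.
  have [i _ Hi] := @arg_maxP _ _ _ (Ordinal n0) predT (fun i => b i * u i w) isT.
  by exists i; rewrite /= ?mem_index_enum// => j _; exact: Hi.
pose st i : set T := [set w | forall j, j != i -> ~ (b i * u i w <= b j * u j w)].
have mst i : measurable (st i).
  apply: (@measurable_forall _ T 'I_n (fun j => j != i)
    (fun j => ~` [set w | b i * u i w <= b j * u j w])) => j _.
  by apply: measurableC; exact: measurable_RV_le.
apply: (@le_trans _ _ (\sum_i pr P (st i))).
  apply: ler_sum => i _; apply/ler_addgt0Pr => e e0.
  (* The strip between the multipliers [b i / (1 + e / (2 * q))] and [b i] has probability at most
     [e] and contains the ties won by [i]. *)
  have e'0 : 0 < e / (2 * q) by rewrite divr_gt0//; lra.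
  have c0 : 0 < b i / (1 + e / (2 * q)) by rewrite divr_gt0//; lra.
  have := pr_strip_le D01 Dq hu uD i c0 e'0 b0.
  rewrite [2 * q * _]mulrC divfK; last by apply/eqP; lra.
  rewrite [(1 + _) * _]mulrC divfK; last by apply/eqP; lra.
  move=> S; apply: le_trans (lerD (lexx _) S).
  apply: le_trans (prU_le P _ _); [|exact: mst|exact: measurableD].
  apply: as_le => //; first by apply: measurableU => //; exact: measurableD.
  move=> w [Ww Uw]; have [sw|nsw] := pselect (st i w); [by left|right].
  split => // W'; apply: nsw => j ji; apply/negP; rewrite -ltNge.
  apply: le_lt_trans (W' j ji) _; rewrite ltr_pM2r; last by case/andP: (Uw i).
  rewrite ltr_pdivrMr; last by lra.
  by rewrite ltr_pMr//; lra.
rewrite -lee_fin -sumEFin.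
under eq_bigr do rewrite -prE//.
rewrite -(measure_bigsetU_ord P predT mst).
  apply: probability_le1; elim/big_ind: _ => // A B; exact: measurableU.
apply/trivIsetP => i j _ _ ij; rewrite -subset0 => w [si sj].
have := si j; rewrite eq_sym ij => /(_ isT) /negP; rewrite -ltNge => /ltW.
exact: sj.
Qed.

End WinningProbability.

(** * Number of rounds of the abstract dynamics on exponents *)

Section Equalization.
Context {R : realType} {n : nat}.
Variables (p : ('I_n -> nat) -> 'I_n -> R) (delta : R) (L : nat).
Hypothesis n_gt0 : (0 < n)%N.
Hypothesis delta_gt0 : 0 < delta.

Definition raised (z : 'I_n -> nat) (i : 'I_n) : bool := p z i <= n%:R^-1.
Definition raise (z : 'I_n -> nat) : 'I_n -> nat := fun i => (z i + raised z i)%N.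
(** The trajectory ignores the loop guard and runs forever, so that the bounds below need no
    stopping time. *)
Definition exponents (k : nat) : 'I_n -> nat := iter k raise (fun=> 0%N).

Hypothesis p_sum : forall z, \sum_i p z i = 1.
Hypothesis p_raised : forall z i, raised z i ->
  p z i <= p (raise z) i <= p z i + delta.
Hypothesis p_unraised : forall z i, ~~ raised z i ->
  p z i - delta <= p (raise z) i <= p z i.
Hypothesis p_gap : forall z i j, (z j + L <= z i)%N -> p z j <= p z i.

Lemma exponentsS k i :
  exponents k.+1 i = (exponents k i + raised (exponents k) i)%N.
Proof. by []. Qed.

Let sum_inv : \sum_(i < n) (n%:R^-1 : R) = 1.
Proof. by rewrite sumr_const card_ord -[LHS]mulr_natr mulVf// pnatr_eq0 -lt0n. Qed.

(** The probabilities average to [1/n], so they cannot all exceed it. *)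
Lemma raised_ex z : exists j, raised z j.
Proof.
apply: contrapT => /forallNP h; have := p_sum z; rewrite -[RHS]sum_inv; apply/eqP.
rewrite gt_eqF//; apply: ltr_sum; first by apply/hasP; exists (Ordinal n_gt0); rewrite ?mem_index_enum.
by move=> j _; rewrite ltNge; apply/negP/h.
Qed.

Lemma unraised_ex z i : p z i < n%:R^-1 -> exists j, ~~ raised z j.
Proof.
move=> zi; apply: contrapT => /forallNP h; have := p_sum z; rewrite -[RHS]sum_inv; apply/eqP.
rewrite lt_eqF// (bigD1 i)//= [ltRHS](bigD1 i)//= ltr_leD//; apply: ler_sum => j _.
by have := h j; rewrite /raised; case: (leP (p z j)).
Qed.

(** A raised agent starts at most at [1/n] and gains at most [delta], so it does not jump above the
    band; an unraised one only falls. Being too high therefore goes back in time. *)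
Lemma high_persist k t i : (t <= k)%N ->
  n%:R^-1 + delta < p (exponents k) i -> n%:R^-1 + delta < p (exponents t) i.
Proof.
elim: k => [|k IH]; first by rewrite leqn0 => /eqP ->.
rewrite leq_eqVlt => /predU1P[->//|/IH{}IH h]; apply: IH; move: h => /=.
case: (boolP (raised (exponents k) i)) => r.
  by have /andP[_] := p_raised r; rewrite /raised in r => ? ?; lra.
by have /andP[_] := p_unraised r => ? ?; lra.
Qed.

Lemma low_persist k t i : (t <= k)%N ->
  p (exponents k) i < n%:R^-1 - delta -> p (exponents t) i < n%:R^-1 - delta.
Proof.
elim: k => [|k IH]; first by rewrite leqn0 => /eqP ->.
rewrite leq_eqVlt => /predU1P[->//|/IH{}IH h]; apply: IH; move: h => /=.
case: (boolP (raised (exponents k) i)) => r.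
  by have /andP[+ _] := p_raised r => ? ?; lra.
by have /andP[+ _] := p_unraised r; rewrite /raised -ltNge in r => ? ?; lra.
Qed.

(* An agent that is still too high was never raised, so whoever is raised lies
   less than [L] above it; every round raises somebody. *)
Lemma high_bound k i : n%:R^-1 + delta < p (exponents k) i -> (k < n * L)%N.
Proof.
move=> hi.
have hit t : (t <= k)%N -> n%:R^-1 < p (exponents t) i.
  by move=> tk; apply: lt_trans (high_persist tk hi); rewrite ltrDl.
(* The state at [k] also governs the round from [k] to [k.+1]; counting that round makes the final
   bound strict. *)
have zi t : (t <= k.+1)%N -> exponents t i = 0%N.
  elim: t => [//|t IH] tk; rewrite exponentsS (IH (ltnW tk)).
  by rewrite /raised leNgt hit.
have zL t j : (t <= k.+1)%N -> (exponents t j <= L)%N.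
  elim: t => [//|t IH] tk; rewrite exponentsS.
  case: (boolP (raised _ j)) => r; last by rewrite addn0 IH// ltnW.
  rewrite addn1 ltnNge; apply/negP => Lz; have := hit _ tk.
  rewrite ltNge => /negP; apply; apply: le_trans r; apply: p_gap.
  by rewrite (zi _ (ltnW tk)).
have zsum t : (t <= \sum_j exponents t j)%N.
  elim: t => [//|t IH]; rewrite (eq_bigr _ (fun j _ => exponentsS t j)).
  rewrite big_split/= -addn1 leq_add//.
  by have [j rj] := raised_ex (exponents t); rewrite (bigD1 j)//= rj.
apply: leq_trans (zsum k.+1) _; rewrite -[n in leqRHS]card_ord -sum_nat_const.
by apply: leq_sum => j _; exact: zL.
Qed.

Lemma exponents_le t j : (exponents t j <= t)%N.
Proof.
by elim: t => [//|t IH]; rewrite exponentsS -addn1 leq_add// leq_b1.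
Qed.

(** Mirror image of [high_bound]: agent [i] is raised in every round, an agent lagging [L] behind it
    is at most as probable and hence raised too, and every round leaves somebody out, so the total
    lag grows by at least one. *)
Lemma low_bound k i : p (exponents k) i < n%:R^-1 - delta -> (k < n * L)%N.
Proof.
move=> hi.
have hit t : (t <= k)%N -> p (exponents t) i < n%:R^-1.
  by move=> tk; apply: lt_trans (low_persist tk hi) _; rewrite gtrBl.
have zi t : (t <= k.+1)%N -> exponents t i = t.
  elim: t => [//|t IH] tk; rewrite exponentsS (IH (ltnW tk)).
  by rewrite /raised (ltW (hit _ tk)) addn1.
have zL t j : (t <= k.+1)%N -> (t - exponents t j <= L)%N.
  elim: t => [//|t IH] tk; rewrite exponentsS.
  case: (boolP (raised _ j)) => r; first by rewrite addn1 subSS IH// ltnW.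
  rewrite addn0 subSn ?exponents_le// ltnNge; apply/negP => Lz.
  move: r; rewrite /raised => /negP; apply; apply: le_trans (ltW (hit _ tk)).
  apply: p_gap; rewrite (zi _ (ltnW tk)).
  by rewrite -leq_subRL ?exponents_le.
have zsum t : (t <= k.+1)%N -> (t <= \sum_j (t - exponents t j))%N.
  elim: t => [//|t IH] tk; have [j rj] := unraised_ex (hit _ tk).
  apply: leq_trans (_ : \sum_j' ((j' == j) + (t - exponents t j')) <= _)%N.
    rewrite big_split/= -add1n leq_add ?(IH (ltnW tk))//.
    by rewrite (bigD1 j)//= eqxx.
  apply: leq_sum => j' _; rewrite exponentsS; have := exponents_le t j'.
  case: eqP => [->|_]; first by rewrite (negbTE rj) addn0 add1n => /subSn ->.
  move: (exponents t j') => m _; rewrite add0n.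
  by case: (raised _ _); rewrite ?addn1 ?subSS// addn0 leq_sub2r.
apply: leq_trans (zsum k.+1 (leqnn _)) _.
rewrite -[n in leqRHS]card_ord -sum_nat_const.
by apply: leq_sum => j _; exact: zL.
Qed.

Lemma equalization :
  exists2 k, (k <= n * L)%N &
    forall i, `|p (exponents k) i - n%:R^-1| <= delta.
Proof.
(* Since both bounds are strict, round [n * L] itself has no agent outside the band. *)
exists (n * L)%N => // i; rewrite ler_norml; apply/andP; split.
  rewrite leNgt; apply/negP => h; suff : (n * L < n * L)%N by rewrite ltnn.
  by apply: (@low_bound _ i); lra.
rewrite leNgt; apply/negP => h; suff : (n * L < n * L)%N by rewrite ltnn.
by apply: (@high_bound _ i); lra.
Qed.

End Equalization.

(** * Values and costs of the timed programs *)

Section Programs.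
Context {R : realType} {n : nat}.
Variables (oracle : oracle_type R n).

Lemma for_each_cost I S (s : seq I) (body : I -> S -> timed S) (c : nat) x :
  (forall i y, ((body i y).2 <= c)%N) ->
  ((for_each s body x).2 <= size s * c.+1)%N.
Proof.
move=> bc; elim: s x => //= i s IH x; rewrite mulSn add1n.
exact: leq_add (bc _ _) (IH _).
Qed.

(** The sequence [x] is the unguarded trajectory; the loop stops at its first index with a false
    guard, found by shifting [x]. The last [cg] pays for the failing test. *)
Lemma while_runs_bounded S (guard : S -> timed bool) (body : S -> timed S)
    (x : nat -> S) (K cg cb : nat) :
  (forall k, (body (x k)).1 = x k.+1) ->
  (forall y, ((guard y).2 <= cg)%N) -> (forall y, ((body y).2 <= cb)%N) ->
  (guard (x K)).1 = false ->
  exists k t, [/\ while_runs guard body (x 0) (x k) t, (guard (x k)).1 = false &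
    (t <= K * (cg + cb) + cg)%N].
Proof.
move=> + gc bc; elim: K x => [|K IH] x xS gK.
  exists 0%N, (guard (x 0)).2; split => //; exact: While_stop.
case g0: (guard (x 0)).1; last first.
  exists 0%N, (guard (x 0)).2; split=> //; first exact: While_stop.
  by rewrite (leq_trans (gc _))// leq_addl.
have [k [t [W gk tk]]] := IH (fun k => x k.+1) (fun k => xS k.+1) gK.
exists k.+1, ((guard (x 0)).2 + (body (x 0)).2 + t)%N; split => //.
  by apply: While_iter; rewrite ?xS.
by rewrite mulSn -[leqRHS]addnA leq_add// leq_add.
Qed.

Lemma em_guard_value delta (s : state) :
  (em_guard oracle delta s).1 = [exists i, delta < `|oracle s.2 i - n%:R^-1|].
Proof.
rewrite /em_guard; set body := (X in for_each _ X).
have E r f : (for_each r body f).1 =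
    f || has (fun i => delta < `|oracle s.2 i - n%:R^-1|) r.
  elim: r f => [|i r IH] f; first by rewrite orbF.
  by rewrite /= IH orbA.
rewrite E; apply/hasP/existsP => [[i _ h]|[i h]]; exists i => //.
by rewrite mem_enum.
Qed.

(** Six operations per agent and one of loop control. *)
Lemma em_guard_cost delta s : ((em_guard oracle delta s).2 <= 7 * n)%N.
Proof. by rewrite (leq_trans (@for_each_cost _ _ _ _ 6 _ _))// size_enum_ord mulnC. Qed.

Lemma em_small_value b :
  (em_small oracle b).1 = [ffun i => oracle b i <= n%:R^-1].
Proof.
rewrite /em_small /=; set body := (X in for_each _ X).
have E r f : (for_each r body f).1 =
    [ffun i => if i \in r then oracle b i <= n%:R^-1 else f i].
  elim: r f => [|i r IH] f; first by apply/ffunP => j; rewrite ffunE.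
  rewrite /= IH; apply/ffunP => j; rewrite !ffunE in_cons.
  by case: eqP => [->|] //=; case: ifP.
by rewrite E; apply/ffunP => i; rewrite !ffunE mem_enum.
Qed.

Lemma em_small_cost b : ((em_small oracle b).2 <= 6 * n)%N.
Proof.
rewrite /em_small /= mulSn leq_add2l.
by rewrite (leq_trans (@for_each_cost _ _ _ _ 4 _ _))// size_enum_ord mulnC.
Qed.

Lemma em_body_value eps (s : state) :
  (em_body oracle eps s).1 =
  let S i := oracle s.2 i <= n%:R^-1 in
  ([ffun i => s.1 i + (S i)%:Z], [ffun i => s.2 i * (1 + eps) ^+ S i]).
Proof.
rewrite /em_body /bind em_small_value; set body := (X in for_each _ X).
pose S i := oracle s.2 i <= n%:R^-1.
(* Without repetitions each agent is updated at most once; [S] is fixed before the loop, so the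
   updates do not influence each other. *)
have E r (x : state) : uniq r -> (for_each r body x).1 =
    ([ffun i => x.1 i + ((i \in r) && S i)%:Z],
     [ffun i => x.2 i * (1 + eps) ^+ ((i \in r) && S i)]).
  elim: r x => [|i r IH] [z b] /=.
    by move=> _; congr pair; apply/ffunP => j; rewrite ffunE ?addr0 ?mulr1.
  move=> /andP[ir ur]; rewrite IH//=.
  congr pair; apply/ffunP => j; rewrite !ffunE in_cons -/(S i);
    case: (eqVneq j i) => [->|ji]; rewrite ?(negbTE ir); case: (S i) => //=;
    by rewrite ?ffunE ?eqxx ?(negbTE ji) ?addr0 ?mulr1 ?expr1.
rewrite [LHS]/= E ?enum_uniq//; congr pair; apply/ffunP => i; rewrite !ffunE mem_enum//.
Qed.

(** At most [6 * n] to compute the set, then per agent one read, seven operations to raise it and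
    one of loop control. *)
Lemma em_body_cost eps s : ((em_body oracle eps s).2 <= 15 * n)%N.
Proof.
rewrite (_ : 15 = 6 + 9)%N// mulnDl; apply: leq_add; first exact: em_small_cost.
rewrite (leq_trans (@for_each_cost _ _ _ _ 8 _ _))// ?size_enum_ord 1?mulnC//.
by move=> i y /=; case: ifP.
Qed.

End Programs.

(** * Logarithmic estimates for the running time *)

Lemma exp_ge_truncn_ln (R : realType) (x y : R) : 1 < x -> 0 < y ->
  y <= x ^+ (Num.truncn (ln y / ln x)).+1.
Proof.
move=> x1 y0; have lx0 : 0 < ln x by rewrite ln_gt0.
have x0 : 0 < x by rewrite (lt_trans ltr01).
rewrite -ler_ln ?posrE ?exprn_gt0// lnXn// -mulr_natl -ler_pdivrMr//.
by rewrite ltW// truncnS_gt.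
Qed.

(** Applying [ln (1 + x) <= x] to the inverse of [1 + e] gives [ln (1 + e) >= e / (1 + e)]. *)
Lemma half_le_ln1D (R : realType) (e : R) : 0 <= e <= 1 -> e / 2 <= ln (1 + e).
Proof.
move=> /andP[e0 e1]; have e10 : 0 < 1 + e by lra.
have : ln (1 + ((1 + e)^-1 - 1)) <= (1 + e)^-1 - 1.
  by apply: le_ln1Dx; rewrite ltrBrDl subrr invr_gt0.
rewrite [1 + (_ - 1)]addrC subrK lnV ?posrE//.
rewrite lerNl opprB; apply: le_trans.
rewrite -(ler_pM2r e10) mulrBl mul1r mulVf ?gt_eqF//.
have : 0 <= e * (1 - e) by rewrite mulr_ge0// subr_ge0.
lra.
Qed.

(** A gap between exponents at which the ratio of multipliers reaches [2 * q]: the [L] of the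
    abstract dynamics. The loop iterates at most [n] times this number. *)
Definition rounds (R : realType) (q delta : R) : nat :=
  (Num.truncn (ln (2 * q) / ln (1 + delta / (2 * q)))).+1.

(** Combines [ln (2 * q) <= 1 + ln q] with [1 / ln (1 + e) <= 2 / e = 4 * q / delta]; the rounding
    up by one is absorbed by [q / delta >= 1], whence [5 = 4 + 1]. *)
Lemma rounds_le (R : realType) (q delta : R) : 1 <= q -> 0 < delta <= 1 ->
  (rounds q delta)%:R <= (5 + 4 * ln q) * (q / delta).
Proof.
move=> q1 /andP[d0 d1]; set e := delta / (2 * q).
have q0 : 0 < q by lra.
have e0 : 0 < e by rewrite divr_gt0//; rewrite mulr_gt0.
have e1 : e <= 1 by rewrite /e ler_pdivrMr; lra.
have le0 : 0 < ln (1 + e) by rewrite ln_gt0// ltrDl.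
have r1 : 1 <= q / delta by rewrite ler_pdivlMr// mul1r; lra.
have lq0 : 0 <= ln q by rewrite ln_ge0.
have l2q : ln (2 * q) <= 1 + ln q.
  rewrite lnM ?posrE//.
  rewrite lerD2r; have := @le_ln1Dx R 1; rewrite -[1 + 1]/(2%:R); apply; lra.
have l2q0 : 0 <= ln (2 * q) by rewrite ln_ge0//; lra.
have : (rounds q delta)%:R <= ln (2 * q) / ln (1 + e) + 1.
  by rewrite /rounds -natr1 lerD2r truncn_le// divr_ge0// ltW.
have : ln (2 * q) / ln (1 + e) <= (1 + ln q) * (4 * (q / delta)).
  apply: ler_pM => //; first by rewrite invr_ge0 ltW.
  rewrite -[leRHS]invrK lef_pV2 ?posrE//; last first.
    by rewrite invr_gt0 mulr_gt0//; lra.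
  apply: le_trans (half_le_ln1D _); last by rewrite ltW.
  rewrite (_ : _^-1 = e / 2) ?e0 ?e1// /e; field.
  by rewrite !gt_eqF.
have : 0 <= ln q * (q / delta) by rewrite mulr_ge0//; lra.
lra.
Qed.

(** Here [122 = 2 + 10 + 22 * 5] and [88 = 22 * 4]. The terms without a logarithm are absorbed
    through [ln q0 <= ln q], which is where [q] must stay away from [1]. *)
Lemma time_bound (R : realType) (q0 q delta : R) (n t : nat) :
  1 < q0 -> q0 <= q -> 0 < delta <= 1 -> (0 < n)%N ->
  (t <= 2 + 10 * n + 22 * n ^ 2 * rounds q delta)%N ->
  t%:R <= (122 / ln q0 + 88) * (n%:R ^+ 2 * q * ln q * delta^-1).
Proof.
move=> q01 q0q dd n0 tn; have q1 : 1 <= q by lra.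
have := rounds_le q1 dd; case/andP: dd => d0 d1.
have r1 : 1 <= q / delta by rewrite ler_pdivlMr// mul1r; lra.
set L : R := (rounds q delta)%:R; set r := q / delta => Lr.
have l0 : 0 < ln q0 by rewrite ln_gt0.
have ll : ln q0 <= ln q by rewrite ler_ln// posrE; lra.
rewrite (_ : n%:R ^+ 2 * q * ln q * delta^-1 = n%:R ^+ 2 * (r * ln q)); last first.
  by rewrite /r; ring.
have n1 : 1 <= n%:R :> R by rewrite ler1n.
have nn : n%:R <= n%:R ^+ 2 :> R by rewrite expr2 ler_peMl.
have rl : r <= r * ln q / ln q0 by rewrite ler_pdivlMr// ler_pM2l// (lt_le_trans ltr01).
apply: (@le_trans _ _ (n%:R ^+ 2 * (122 * r + 88 * (r * ln q)))).
  apply: (@le_trans _ _ (2 + 10 * n%:R + 22 * n%:R ^+ 2 * L)).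
    move: tn; rewrite -(ler_nat R) natrD [(2 + _)%:R]natrD [(10 * _)%:R]natrM.
    by rewrite [(22 * _ * _)%:R]natrM [(22 * _)%:R]natrM natrX.
  have : n%:R ^+ 2 * L <= n%:R ^+ 2 * ((5 + 4 * ln q) * r).
    by rewrite ler_wpM2l ?sqr_ge0.
  have : n%:R ^+ 2 <= n%:R ^+ 2 * r by rewrite ler_peMr ?sqr_ge0.
  lra.
rewrite [leRHS]mulrCA; apply: ler_wpM2l; first exact: sqr_ge0.
lra.
Qed.

(** * The algorithm run on independent utilities *)

Definition multipliers (R : realType) (n : nat) (eps : R) (z : 'I_n -> nat) :
  {ffun 'I_n -> R} := [ffun i => (1 + eps) ^+ z i].

(** The constant depends on [q0] only. Termination and correctness hold for every [q]; the time
    bound asks [q0 <= q] because its right-hand side vanishes at [q = 1], while the running time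
    does not. *)
Theorem theorem5 (R : realType) (q0 : R) (hq0 : 1 < q0) :
  exists C : R, 0 < C /\
  forall (n : nat) (hn : (0 < n)%N)
    (D : 'I_n -> probability (measurableTypeR R) R) (q delta : R)
    (D01 : forall j, on_unit_interval (D j))
    (Dq : forall j, has_density_le (D j) q)
    (hdelta : 0 < delta <= 1)
    (d : measure_display) (T : measurableType d) (P : probability T R)
    (u : 'I_n -> {RV P >-> R})
    (hu : mutually_independent u)
    (uD : forall j, has_distribution (u j) (D j))
    (oracle : oracle_type R n)
    (horacle : forall beta : {ffun 'I_n -> R}, (forall j, 0 < beta j) ->
       forall i, oracle beta i = resulting_probability u beta i),
  exists (z : {ffun 'I_n -> int}) (beta : {ffun 'I_n -> R}) (t : nat),
    [/\ em_run oracle delta q z beta t,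
        forall i, beta i = (1 + delta / (2 * q)) ^ z i,
        forall i, 0 < beta i,
        forall i, n%:R^-1 - delta <= resulting_probability u beta i
                    <= n%:R^-1 + delta &
        q0 <= q -> t%:R <= C * (n%:R ^+ 2 * q * ln q * delta^-1)].
Proof.
exists (122 / ln q0 + 88); split.
  by rewrite addr_gt0// divr_gt0// ln_gt0.
move=> n hn D q delta D01 Dq hdelta d T P u hu uD oracle horacle.
have q1 := density_bound_ge1 D01 Dq uD (Ordinal hn).
have [d0 d1] := andP hdelta.
set eps := delta / (2 * q).
have eps0 : 0 < eps by rewrite divr_gt0// mulr_gt0// (lt_le_trans ltr01).
have epsE : 2 * q * eps = delta.
  by rewrite mulrC divfK// gt_eqF// mulr_gt0// (lt_le_trans ltr01).
have r1 : 1 < 1 + eps by rewrite ltrDl.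
have r0 : 0 < 1 + eps by rewrite (lt_trans ltr01).
have b0 (z : 'I_n -> nat) i : 0 < multipliers eps z i by rewrite ffunE exprn_gt0.
have bM (z z' : 'I_n -> nat) i j : multipliers eps z i * multipliers eps z' j =
    (1 + eps) ^+ (z i + z' j) by rewrite !ffunE exprD.
pose p z i := resulting_probability u (multipliers eps z) i.
(* Comparing ratios of multipliers becomes comparing differences of exponents, written additively to
   stay in [nat]. In [p_lip] a slack of one costs a factor [1 + eps], hence
   [2 * q * eps = delta]. *)
have p_le z z' i : (forall j, z i + z' j <= z j + z' i)%N -> p z i <= p z' i.
  move=> zz; rewrite /p !resulting_probabilityE.
  apply: (pr_wins_mono D01 Dq hu uD) => // j _.
  by rewrite !bM ler_weXn2l// ltW.
have p_lip z z' i : (forall j, z i + z' j <= (z j + z' i).+1)%N ->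
    p z i <= p z' i + delta.
  move=> zz; rewrite /p !resulting_probabilityE -epsE.
  apply: (pr_wins_lip D01 Dq hu uD) => // j _.
  by rewrite !bM -exprS ler_weXn2l// ltW.
have p_raised z i : raised p z i -> p z i <= p (raise p z) i <= p z i + delta.
  move=> zi; rewrite p_le ?p_lip//= /raise zi => j; last by lia.
  by case: (raised p z j); lia.
have p_unraised z i : ~~ raised p z i ->
    p z i - delta <= p (raise p z) i <= p z i.
  move=> zi; rewrite lerBlDr p_le ?p_lip//= /raise (negbTE zi) => j; last by lia.
  by case: (raised p z j); lia.
have p_sum z : \sum_i p z i = 1.
  rewrite -[RHS](pr_wins_sum D01 Dq hu uD hn (b0 z)); apply: eq_bigr => i _.
  exact: resulting_probabilityE.
have p_gap z i j : (z j + rounds q delta <= z i)%N -> p z j <= p z i.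
  move=> zij; rewrite /p !resulting_probabilityE.
  apply: (pr_wins_swap D01 Dq hu uD) => //.
  apply: (@le_trans _ _ ((1 + eps) ^+ (z j + rounds q delta))).
    rewrite ffunE exprD mulrC ler_pM2l ?exprn_gt0//.
    by apply: exp_ge_truncn_ln => //; rewrite mulr_gt0// (lt_le_trans ltr01).
  by rewrite ffunE ler_weXn2l// ltW.
have [K Kle Kgood] := equalization hn d0 p_sum p_raised p_unraised p_gap.
pose x k : state := ([ffun i => (exponents p k i)%:Z],
  multipliers eps (exponents p k)).
have xo k i : oracle (x k).2 i = p (exponents p k) i.
  by apply: horacle => j; exact: b0.
have xS k : (em_body oracle (em_eps delta q).1 (x k)).1 = x k.+1.
  rewrite em_body_value /x; congr pair; apply/ffunP => i; rewrite !ffunE -/(x k);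
    by rewrite horacle//= /raise -/(raised p _ _) ?PoszD ?exprD.
have good k : (em_guard oracle delta (x k)).1 = false <->
    forall i, `|p (exponents p k) i - n%:R^-1| <= delta.
  rewrite em_guard_value; split => [/negbT /existsPn h i|h].
    by have := h i; rewrite xo -leNgt.
  by apply/negbTE/existsPn => i; rewrite xo -leNgt.
have [k [t [run stop tle]]] := while_runs_bounded xS
  (em_guard_cost oracle delta) (em_body_cost oracle (em_eps delta q).1)
  ((good K).2 Kgood).
(* Two operations compute [eps], two arrays are allocated, and the last [n] writes the output. *)
exists (x k).1, (x k).2, (2 + (n + (n + 0)) + t + n)%N; split.
- by exists t.
- by move=> i; rewrite !ffunE.
- exact: b0.
- move=> i; have := (good k).1 stop i; rewrite ler_norml => /andP[lo hi].
  by apply/andP; split; [rewrite -lerBrDl|rewrite -lerBlDl]; rewrite ?opprB.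
- move=> q0q; apply: time_bound => //.
  have Kle' : (K * 22 <= n * rounds q delta * 22)%N by rewrite leq_mul2r Kle orbT.
  nia.
Qed.
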